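(* Let $(S,\phi)$ be an interaction which is exchangeable, and let $(X,E)$ be a symmetric digraph which is connected, locally finite and infinite (i.e. $X$ is infinite). Suppose $f\in C^0_{\mathrm{unif}}(S^X)$ is a uniform function which is invariant via transitions of $(S^X,\Phi_E)$. Then there exists a conserved quantity $\xi\colon S\to\mathbb{R}$ for $(S,\phi)$ such that $f=\xi_X$ in $C^0_{\mathrm{unif}}(S^X)$.
   Context: Graphs. A symmetric digraph $(X,E)$ is a set $X$ of vertices with a set $E\subset X\times X$ of edges such that $(x,y)\in E$ iff $(y,x)\in E$. It is locally finite if $\{(x,y)\in E\mid y\in X\}$ is finite for every $x\in X$, and connected if any two vertices are joined by a finite path. $d_X$ is the graph distance, and $\operatorname{diam}(\Lambda):=\sup_{x,y\in\Lambda}d_X(x,y)$ for $\Lambda\subset X$ (with $\operatorname{diam}(\emptyset)=0$). Uniform functions. Let $S$ be a non-empty set, $S^X:=\prod_{x\in X}S$ the configuration space. For $\Lambda\subset X$, $C(S^\Lambda)$ is the space of real functions on $S^\Lambda$, viewed as functions on $S^X$ (and on $S^X_*$ below) depending only on the components in $\Lambda$. $\mathscr{I}$ is the set of finite subsets of $X$ (including $\emptyset$). Fix a base state $*\in S$. $S^X_*\subset S^X$ is the set of $\eta$ with $\eta_x=*$ for all but finitely many $x$; $\star$ is the configuration with all components $*$; $C(S^X_* )$ is the space of all functions $S^X_*\to\mathbb{R}$. For $f\in C(S^X_* )$ and $\Lambda\subset X$, $\iota^\Lambda_*f(\eta):=f(\eta|_\Lambda)$, where $\eta|_\Lambda$ agrees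 with $\eta$ on $\Lambda$ and equals $*$ outside $\Lambda$. For $\Lambda\in\mathscr{I}$, $C_\Lambda(S^X_* )$ is the space of $f\in C(S^\Lambda)$ such that $\iota^{\Lambda'}_*f=0$ for every finite $\Lambda'\subset X$ with $\Lambda\not\subset\Lambda'$. Every $f\in C(S^X_* )$ has a unique expansion $f=\sum_{\Lambda\in\mathscr{I}}f^*_\Lambda$ with $f^*_\Lambda\in C_\Lambda(S^X_* )$ (a finite sum at each point of $S^X_*$). $f$ is uniform if there is $R>0$ with $f^*_\Lambda=0$ whenever $\operatorname{diam}(\Lambda)>R$. $C_{\mathrm{unif}}(S^X_* )$ is the space of uniform functions and $C^0_{\mathrm{unif}}(S^X_* )$ its quotient by the constant functions. Independence of base state. For base states $*,*'\in S$ there is an $\mathbb{R}$-linear isomorphism $C_{\mathrm{unif}}(S^X_* )\cong C_{\mathrm{unif}}(S^X_{*'})$ sending $f=\sum_\Lambda f^*_\Lambda$ to $\sum_{\Lambda'\in\mathscr{I}}f^{*'}_{\Lambda'}$, where $f^{*'}_\emptyset:=f(\star)$ and, for $\Lambda'\ne\emptyset$, $f^{*'}_{\Lambda'}:=\sum_{\Lambda\in\mathscr{I},\,\Lambda'\subset\Lambda}(f^*_\Lambda)^{*'}_{\Lambda'}$ (a finite sum), with $(f^*_\Lambda)^{*'}_{\Lambda'}$ the components of the expansion of $f^*_\Lambda\in C(S^\Lambda)\subset C(S^X_{*'})$ for the base state $*'$. It induces an isomorphism $C^0_{\mathrm{unif}}(S^X_* )\cong C^0_{\mathrm{unif}}(S^X_{*'})$,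 and via these identifications the space is simply denoted $C^0_{\mathrm{unif}}(S^X)$. Differences. For $f\in C^0_{\mathrm{unif}}(S^X)$ and $\eta,\eta'\in S^X$ with $\Delta_{\eta,\eta'}:=\{x\in X\mid\eta_x\ne\eta'_x\}$ finite, one defines $f(\eta')-f(\eta):=\sum_{\Lambda\in\mathscr{I},\,\Lambda\cap\Delta_{\eta,\eta'}\neq\emptyset}(f^*_\Lambda(\eta')-f^*_\Lambda(\eta))$, a finite sum independent of the choice of $*$. Interactions. An interaction $(S,\phi)$ is a non-empty set $S$ with a subset $\phi\subset(S\times S)\times(S\times S)$ such that $(S\times S,\phi)$ is a symmetric digraph. It is exchangeable if for any $(s_1,s_2)\in S\times S$, the elements $(s_1,s_2)$ and $(s_2,s_1)$ lie in the same connected component of $(S\times S,\phi)$. A conserved quantity for $(S,\phi)$ is a function $\xi\colon S\to\mathbb{R}$ such that $(s_1,s_2)\mapsto\xi(s_1)+\xi(s_2)$ is constant on the connected components of $(S\times S,\phi)$. For such $\xi$, $\xi_X:=\sum_{x\in X}\xi_x\in C^0_{\mathrm{unif}}(S^X)$ with $\xi_x(\eta):=\xi(\eta_x)$; concretely, for a base state $*$, after replacing $\xi$ by $\xi-\xi( * )$ so that $\xi( * )=0$, $\xi_X$ is the class of the function $\eta\mapsto\sum_{x\in X}\xi(\eta_x)$ on $S^X_*$. Transitions. $\Phi_E\subset S^X\times S^X$ is the set of pairs $(\eta,\eta')$ for which there is $e=(x,y)\in E$ with $((\eta_x,\eta_y),(\eta'_x,\eta'_y))\in\phi$ and $\eta_z=\eta'_z$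 for all $z\neq x,y$. $f\in C^0_{\mathrm{unif}}(S^X)$ is invariant via transitions of $(S^X,\Phi_E)$ if $f(\eta')-f(\eta)=0$ for all $(\eta,\eta')\in\Phi_E$. *)

(* Defs.v *)
From HB Require Import structures.
From mathcomp Require Import all_boot all_order all_algebra.
From mathcomp Require Import generic_quotient ring_quotient finmap.
From mathcomp Require Import all_classical all_reals ereal.

Set Implicit Arguments.
Unset Strict Implicit.
Unset Printing Implicit Defensive.

Import Order.TTheory GRing.Theory Num.Theory.

Local Open Scope classical_set_scope.
Local Open Scope ring_scope.

(* A symmetric digraph on [V] is a relation [E : rel V] with [symmetric E];
   loops are allowed.  An interaction is such a relation on [S * S]. *)

Section Graphs.
Variables (V : Type) (E : rel V).

Definition joined (x y : V) : Prop := exists2 p, path E x p & last x p = y.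

Definition graph_connected : Prop := forall x y, joined x y.

Definition locally_finite : Prop :=
  forall x, finite_set [set (x, y) | y in [set y | E x y]].

(* [+oo] when [x] and [y] are not joined by a path *)
Definition graph_dist (R : realType) (x y : V) : \bar R :=
  ereal_inf [set (size p)%:R%:E | p in [set p | path E x p /\ last x p = y]].

(* [ereal_sup set0] is [-oo], whence the case distinction *)
Definition diam (R : realType) (A : set V) : \bar R :=
  if A == set0 then 0%E
  else ereal_sup [set graph_dist R xy.1 xy.2 | xy in A `*` A].

End Graphs.

(* [S^X] is [X -> S], and the set of finite subsets of [X] is [{fset X}].
   The base state is [star]. *)

Section Configurations.
Variables (S : Type) (star : S) (X : choiceType).

(* [S^X_star] *)
Definition fconf : Type :=
  {eta : X -> S | finite_set [set x | eta x <> star]}.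

Lemma finite_restr (L : {fset X}) (eta : X -> S) :
  finite_set [set x | patch (fun=> star) [set` L] eta x <> star].
Proof.
apply: (sub_finite_set _ (finite_fset L)) => x /=.
by rewrite /patch mem_setE; case: ifP.
Qed.

(* [eta|_L] *)
Definition restr (L : {fset X}) (eta : X -> S) : fconf :=
  exist _ (patch (fun=> star) [set` L] eta) (finite_restr L eta).

End Configurations.

Section Expansion.
Variables (R : realType) (S : Type) (star : S) (X : choiceType).
Implicit Types (f : fconf star X -> R) (g : (X -> S) -> R) (L M : {fset X}).
Implicit Types (F G : {fset X} -> (X -> S) -> R).

(* Elements of [C(S^L)] are represented by functions on the whole of [S^X]. *)
Definition depends_only_on L g : Prop :=
  forall eta eta' : X -> S, {in L, eta =1 eta'} -> g eta = g eta'.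

(* [C_L(S^X_star)]: the second clause says that [iota^{L'}_star g = 0]. *)
Definition Cspace L : set ((X -> S) -> R) :=
  [set g | depends_only_on L g /\
     forall L', ~~ (L `<=` L')%fset ->
       forall eta : fconf star X, g (sval (restr star L' (sval eta))) = 0].

(* By definition of [Cspace] the sum has finitely many nonzero terms. *)
Definition is_expansion f F : Prop :=
  (forall L, Cspace L (F L)) /\
  (forall eta : fconf star X,
     f eta = \sum_(L \in [set: {fset X}]) F L (sval eta)).

Lemma fconf_eqP (eta eta' : fconf star X) : sval eta =1 sval eta' -> eta = eta'.
Proof. by case: eta eta' => [u up] [v vp] /funext uv; exact: eq_exist. Qed.

Lemma restr_in L (eta : X -> S) x :
  x \in L -> sval (restr star L eta) x = eta x.
Proof. by move=> xL; rewrite /= /patch mem_setE xL. Qed.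

Lemma restrE L (eta : X -> S) x :
  sval (restr star L eta) x = if x \in L then eta x else star.
Proof. by rewrite /= /patch mem_setE. Qed.

Lemma restr_restr L M (eta : X -> S) :
  restr star L (sval (restr star M eta)) = restr star (L `&` M)%fset eta.
Proof.
by apply: fconf_eqP => x; rewrite !restrE inE; case: (x \in L).
Qed.

Lemma restr_supp (eta : fconf star X) :
  exists L, restr star L (sval eta) = eta.
Proof.
exists (fset_set [set x | sval eta x <> star]); apply: fconf_eqP => x.
rewrite restrE in_fset_set; last exact: (svalP eta).
by case: ifPn => // /negP; rewrite inE/= => /contrapT.
Qed.

Lemma Cspace_restr L M g (eta : X -> S) : Cspace L g ->
  g (sval (restr star M eta)) = if (L `<=` M)%fset then g eta else 0.
Proof.
move=> [dg zg]; case: ifPn => [LM|LM].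
  by apply: dg => x xL; rewrite restr_in// (fsubsetP LM).
by rewrite -(zg M LM (restr star M eta)) restr_restr fsetIid.
Qed.

Lemma sum_restr F M (eta : X -> S) : (forall L, Cspace L (F L)) ->
  \sum_(L \in [set: {fset X}]) F L (sval (restr star M eta)) =
  \sum_(L <- fpowerset M) F L eta.
Proof.
move=> CF; rewrite (fsbigTE (fpowerset M)) => [|L].
  apply: eq_big_seq => L; rewrite fpowersetE => LM.
  by rewrite (Cspace_restr _ _ (CF L)) LM.
by rewrite fpowersetE => /negPf LM; rewrite (Cspace_restr _ _ (CF L)) LM.
Qed.

Lemma expansion_restr f F M (eta : X -> S) : is_expansion f F ->
  f (restr star M eta) = \sum_(L <- fpowerset M) F L eta.
Proof. by move=> [CF ->]; exact: sum_restr. Qed.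

Lemma expansion_unique f F G : is_expansion f F -> is_expansion f G -> F = G.
Proof.
move=> fF fG; apply/funext => L; have [n] := ubnP #|` L|%fset.
elim: n L => // n IHn L; rewrite ltnS => leLn; apply/funext => eta.
have := expansion_restr L eta fF; rewrite (expansion_restr L eta fG).
have LL : L \in fpowerset L by rewrite fpowersetE.
rewrite (bigD1_seq L) ?fset_uniq//= => /esym; rewrite (bigD1_seq L) ?fset_uniq//=.
suff -> : \sum_(M <- fpowerset L | M != L) G M eta =
          \sum_(M <- fpowerset L | M != L) F M eta by move=> /addIr.
rewrite big_seq_cond [RHS]big_seq_cond; apply: eq_bigr => M.
rewrite fpowersetE => /andP[ML neqML]; rewrite IHn//.
by apply: leq_trans leLn; apply: fproper_ltn_card; rewrite fproperEneq neqML.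
Qed.

Fixpoint mobius f n L (eta : X -> S) : R :=
  if n is n'.+1 then
    f (restr star L eta) - \sum_(M <- fpowerset L | M != L) mobius f n' M eta
  else 0.

Lemma expansion_exists f : exists F, is_expansion f F.
Proof.
pose F L := mobius f #|` L|%fset.+1 L.
have mE n L : (#|` L|%fset < n)%N -> mobius f n L = F L.
  have [k] := ubnP n; elim: k n L => // k IHk [//|n] L.
  rewrite ltnS => nk; rewrite ltnS => Ln; apply/funext => eta.
  rewrite /F /=.
  congr (_ - _); rewrite big_seq_cond [RHS]big_seq_cond.
  apply: eq_bigr => M; rewrite fpowersetE => /andP[ML neqML].
  have ltML : (#|` M|%fset < #|` L|%fset)%N.
    by apply: fproper_ltn_card; rewrite fproperEneq neqML.
  rewrite (IHk n M nk (leq_trans ltML Ln)) (IHk _ M _ ltML)//.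
  exact: leq_ltn_trans nk.
have FE L eta : \sum_(M <- fpowerset L) F M eta = f (restr star L eta).
  rewrite (bigD1_seq L) ?fset_uniq//=; last by rewrite fpowersetE.
  rewrite -[RHS](subrK (\sum_(M <- fpowerset L | M != L) F M eta)).
  have -> : F L eta = f (restr star L eta) -
    \sum_(M <- fpowerset L | M != L) mobius f #|` L|%fset M eta by [].
  congr (_ - _ + _); rewrite big_seq_cond [RHS]big_seq_cond.
  apply: eq_bigr => M; rewrite fpowersetE => /andP[ML neqML].
  by rewrite mE//; apply: fproper_ltn_card; rewrite fproperEneq neqML.
have CF L : Cspace L (F L).
  have [n] := ubnP #|` L|%fset; elim: n L => // n IHn L; rewrite ltnS => Ln.
  have FLE eta : F L eta =
      f (restr star L eta) - \sum_(M <- fpowerset L | M != L) F M eta.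
    rewrite -FE (bigD1_seq L) ?fset_uniq//= ?addrK//.
    by rewrite fpowersetE.
  have ltn M : (M `<=` L)%fset -> M != L -> Cspace M (F M).
    move=> ML neqML; apply: IHn; apply: leq_trans Ln.
    by apply: fproper_ltn_card; rewrite fproperEneq neqML.
  split=> [eta eta' ee|L' LL' eta].
    rewrite !FLE; congr (f _ - _).
      by apply: fconf_eqP => x; rewrite !restrE; case: ifPn => // /ee.
    rewrite big_seq_cond [RHS]big_seq_cond; apply: eq_bigr => M.
    rewrite fpowersetE => /andP[ML neqML]; apply: (ltn M ML neqML).1 => x xM.
    by apply: ee; rewrite (fsubsetP ML).
  rewrite FLE restr_restr -FE; apply/eqP; rewrite subr_eq0; apply/eqP.
  pose G M := if (M `<=` L `&` L')%fset then F M else fun=> 0.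
  have CG M : Cspace M (G M).
    rewrite /G; case: ifPn => [|_]; last by split.
    rewrite fsubsetI => /andP[ML ML']; apply: ltn => //.
    by apply: contraNneq LL' => <-.
  transitivity (\sum_(M <- fpowerset (L `&` L')%fset) G M (sval eta)).
    by apply: eq_big_seq => M; rewrite fpowersetE /G => ->.
  rewrite -sum_restr// (fsbigTE (fpowerset L)) => [|M]; last first.
    by rewrite fpowersetE /G fsubsetI => /negPf ->.
  rewrite (bigD1_seq L) ?fset_uniq//= ?fpowersetE//.
  rewrite {1}/G fsubsetI fsubset_refl (negPf LL')/= add0r.
  rewrite big_seq_cond [RHS]big_seq_cond; apply: eq_bigr => M.
  rewrite fpowersetE => /andP[ML neqML]; have CM := ltn M ML neqML.
  rewrite (Cspace_restr _ _ CM) (Cspace_restr _ _ (CG M)) /G fsubsetI ML/=.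
  by case: (M `<=` L')%fset.
exists F; split=> // eta; have [M etaE] := restr_supp eta.
by rewrite -etaE sum_restr// FE.
Qed.

(* [f^*_L] *)
Definition component f : {fset X} -> (X -> S) -> R :=
  sval (cid (expansion_exists f)).

Lemma componentP f : is_expansion f (component f).
Proof. exact: svalP (cid (expansion_exists f)). Qed.

Lemma componentE f F : is_expansion f F -> component f = F.
Proof. exact/expansion_unique/componentP. Qed.

Lemma expansionB f (g : fconf star X -> R) F G : is_expansion f F -> is_expansion g G ->
  is_expansion (f - g) (F - G).
Proof.
move=> fF gG; have CFG L : Cspace L ((F - G) L).
  have [[dF zF] [dG zG]] := (fF.1 L, gG.1 L).
  split=> [eta eta' ee|L' LL' eta]; rewrite !fctE/=.
    by rewrite (dF _ _ ee) (dG _ _ ee).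
  by rewrite !(zF, zG)// subrr.
split=> // eta; have [M <-] := restr_supp eta.
rewrite sum_restr// !fctE (expansion_restr _ _ fF) (expansion_restr _ _ gG).
by rewrite -sumrB.
Qed.

Lemma componentB f (g : fconf star X -> R) : component (f - g) = component f - component g.
Proof. by apply/componentE/expansionB; exact: componentP. Qed.

Lemma component_cst (c : R) L : L != fset0 -> component (cst c) L = 0.
Proof.
move=> L0; rewrite (componentE (F := fun M => if M == fset0 then cst c else 0)).
  by rewrite (negPf L0).
split=> [M|eta].
  case: eqP => [->|_]; split=> //= L'.
  by rewrite fsub0set.
rewrite (fsbigTE [fset fset0]%fset) ?big_seq_fset1 ?eqxx//.
by move=> M; rewrite inE => /negPf ->.
Qed.

End Expansion.

Section Uniform.
Variables (R : realType) (S : Type) (X : choiceType) (E : rel X) (star : S).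

Definition uniform (f : fconf star X -> R) : Prop :=
  exists2 r : R, 0 < r &
    forall L : {fset X}, (r%:E < diam E R [set` L])%E -> component f L = 0.

Definition unif : {pred fconf star X -> R} := fun f => `[< uniform f >].

Lemma unif_zmod_closed : zmod_closed unif.
Proof.
split=> [|f g /asboolP[r r0 fr] /asboolP[s s0 gs]]; apply/asboolP.
  exists 1 => // L _; rewrite -[X in component X](subrr 0) componentB.
  by rewrite subrr.
exists (Num.max r s) => [|L]; first by rewrite lt_max r0.
rewrite EFin_max gt_max => /andP[rL sL].
rewrite componentB -[LHS]/(component f L - component g L).
by rewrite fr// gs// subrr.
Qed.

HB.instance Definition _ :=
  GRing.isZmodClosed.Build (fconf star X -> R) unif unif_zmod_closed.

(* [C_unif(S^X_star)] *)
Record Cunif := MkCunif {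
  Cunif_fun :> fconf star X -> R;
  _ : Cunif_fun \in unif }.

HB.instance Definition _ := [isSub for Cunif_fun].
HB.instance Definition _ := [Choice of Cunif by <:].
HB.instance Definition _ := [SubChoice_isSubZmodule of Cunif by <:].

Definition constants : {pred Cunif} :=
  fun f => `[< exists c : R, forall eta, f eta = c >].

Lemma constants_zmod_closed : zmod_closed constants.
Proof.
split=> [|f g /asboolP[c fc] /asboolP[d gd]]; apply/asboolP.
  by exists 0.
by exists (c - d) => eta; rewrite -(fc eta) -(gd eta).
Qed.

HB.instance Definition _ :=
  GRing.isZmodClosed.Build Cunif constants constants_zmod_closed.

(* [C^0_unif(S^X_star)], which stands for [C^0_unif(S^X)]: the latter is
   defined through any choice of the base state. *)
Definition C0unif : Type := {ideal_quot constants}.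

HB.instance Definition _ := GRing.Zmodule.on C0unif.

Definition C0unif_class (f : Cunif) : C0unif := \pi_{ideal_quot constants}%qT f.

(* [f(eta') - f(eta)], computed on a representative of the class [f]; it does
   not depend on the representative by [diffE]. *)
Definition diff (f : C0unif) (eta eta' : X -> S) : R :=
  let g : Cunif := repr f in
  \sum_(L \in [set L : {fset X} | exists2 x, x \in L & eta x <> eta' x])
     (component g L eta' - component g L eta).

Lemma diffE (f : Cunif) eta eta' : diff (C0unif_class f) eta eta' =
  \sum_(L \in [set L : {fset X} | exists2 x, x \in L & eta x <> eta' x])
     (component f L eta' - component f L eta).
Proof.
set g : Cunif := repr (C0unif_class f).
have /asboolP[c gfc] : g - f \in constants.
  by rewrite Quotient.idealrBE reprK.
have gE : (g : fconf star X -> R) = (f : fconf star X -> R) - cst (- c).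
  by apply/funext => z; rewrite !fctE opprK -(gfc z)/= addrC subrK.
apply: eq_fsbigr => L; rewrite inE => -[x xL _].
have L0 : L != fset0 by apply: contraTneq xL => ->; rewrite inE.
rewrite -/g gE componentB.
rewrite -[_ L]/(component f L - component (cst (- c)) L).
by rewrite component_cst// subr0.
Qed.

End Uniform.

Arguments unif {R S X} E star.

Section Interactions.
Variables (S : Type) (phi : rel (S * S)).

Definition exchangeable : Prop :=
  forall s1 s2, joined phi (s1, s2) (s2, s1).

Definition conserved_quantity (R : realType) (xi : S -> R) : Prop :=
  forall s t, joined phi s t -> xi s.1 + xi s.2 = xi t.1 + xi t.2.

(* [Phi_E] *)
Definition transition (X : choiceType) (E : rel X) (eta eta' : X -> S) : Prop :=
  exists x y, [/\ E x y, phi (eta x, eta y) (eta' x, eta' y) &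
    forall z, z <> x -> z <> y -> eta z = eta' z].

Definition transition_invariant (R : realType) (X : choiceType) (E : rel X)
    (star : S) (f : C0unif R E star) : Prop :=
  forall eta eta', transition E eta eta' -> diff f eta eta' = 0.

End Interactions.

Section ConservedSum.
Variables (R : realType) (S : Type) (X : choiceType) (E : rel X) (star : S).
Variable xi : S -> R.

(* Subtracting [xi star] makes the sum finite on [S^X_star]. *)
Definition conserved_sum_fun (eta : fconf star X) : R :=
  \sum_(x \in [set: X]) (xi (sval eta x) - xi star).

Definition conserved_sum_component (L : {fset X}) (eta : X -> S) : R :=
  if #|` L|%fset == 1%N then \sum_(x <- L) (xi (eta x) - xi star) else 0.

Lemma conserved_sum_expansion :
  is_expansion conserved_sum_fun conserved_sum_component.
Proof.
split=> [L|eta].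
  split=> [eta eta' ee|L' LL' eta]; rewrite /conserved_sum_component.
    case: ifPn => // /cardfs1P[y Ly]; rewrite Ly !big_seq_fset1.
    by rewrite ee// Ly inE.
  case: ifPn => // /cardfs1P[y Ly]; rewrite Ly big_seq_fset1 restrE.
  by move: LL'; rewrite Ly fsub1set => /negPf ->; rewrite subrr.
transitivity (\sum_(x \in [set: X])
    conserved_sum_component [fset x]%fset (sval eta)).
  apply: eq_fsbigr => x _.
  by rewrite /conserved_sum_component cardfs1 eqxx big_seq_fset1.
rewrite -(fsbig_image [set: X] (fun x => [fset x]%fset)
  (fun L => conserved_sum_component L (sval eta))); last first.
  by move=> x y _ _; exact: fset1_inj.
apply: fsbig_widen => // L [_ nL] /=; rewrite /conserved_sum_component.
by case: ifPn => // /cardfs1P[y Ly]; case: nL; exists y.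
Qed.

Lemma conserved_sum_unif : conserved_sum_fun \in unif E star.
Proof.
apply/asboolP; exists 1 => // L; rewrite (componentE conserved_sum_expansion).
move=> dL; apply/funext => eta; rewrite /conserved_sum_component.
case: ifPn => // /cardfs1P[y Ly]; exfalso; move: dL; apply/negP.
rewrite -leNgt /diam; case: ifPn => [_|_]; first by rewrite lee_fin.
apply: ge_ereal_sup => _ [[a b] /= [aL bL] <-]; move: aL bL.
rewrite Ly /= !inE => /eqP -> /eqP ->.
apply: (@le_trans _ _ 0%E); last by rewrite lee_fin.
by apply: ereal_inf_lbound; exists [::].
Qed.

(* [xi_X] *)
Definition conserved_sum : C0unif R E star :=
  C0unif_class (MkCunif conserved_sum_unif).

End ConservedSum.

(* Main.v *)
Require Import Defs.
From mathcomp Require Import all_boot all_order all_algebra.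
From mathcomp Require Import generic_quotient ring_quotient finmap.
From mathcomp Require Import all_classical all_reals ereal.

(** Everything takes place on configurations that equal the base state outside
    a finite set.  Think of a site whose state is not the base state as
    occupied by a particle.

    On an edge, an exchangeable interaction can exchange the two states, so an
    invariant function [f] does not change under exchanges along edges
    ([joined_invariant]), and by conjugating along a path it does not change
    under the exchange of any two sites ([exchange_invariant]).  In particular
    a particle may be moved to any vacant site without changing [f].

    On the other hand [f] is uniform.  If the site [y] is farther from the
    support of [eta] than the range of [f], the only component of [f] that
    feels a particle added to [eta] at [y] is the one of the singleton [{y}];
    the increment of [f] is then the same as if [eta] were empty
    ([far_increment]).  Balls are finite while the graph is infinite, so such a
    [y] always exists ([exists_far]).

    Together: adding a particle in state [s] at any vacant site [x] of any
    [eta] has the same effect as adding it at a far site, which has the same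
    effect as adding it to the empty configuration, and the latter increment
    [xi s] does not depend on the site ([increment_vacant]).  By induction on
    the support, [f eta] is [f] of the empty configuration plus the sum of the
    [xi (eta x)] ([invariant_sum]).  Evaluating [f] on two particles sitting at
    the ends of an edge shows that [xi] is conserved ([increment_conserved]). *)

Set Implicit Arguments.
Unset Strict Implicit.
Unset Printing Implicit Defensive.

Import Order.TTheory GRing.Theory Num.Theory.

Local Open Scope classical_set_scope.
Local Open Scope ring_scope.

(** * Balls in a locally finite graph *)

Section Balls.
Variables (X : choiceType) (E : rel X).

Definition graph_ball (n : nat) (x : X) : set X :=
  [set y | exists p, [/\ path E x p, last x p = y & (size p <= n)%N]].

Lemma graph_ball_finite n x : locally_finite E -> finite_set (graph_ball n x).
Proof.
move=> E_lf; elim: n x => [|n IHn] x.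
  apply: (sub_finite_set _ (finite_set1 x)) => y [p [_ <-]].
  by rewrite leqn0 size_eq0 => /eqP ->.
have Ex_fin : finite_set [set y | E x y].
  have := finite_image snd (E_lf x); apply: sub_finite_set => y Exy.
  by exists (x, y) => //; exists y.
have sub : graph_ball n.+1 x `<=`
    [set x] `|` \bigcup_(z in [set z | E x z]) graph_ball n z.
  move=> y [[|z p] [/= xp <- szp]]; first by left.
  by case/andP: xp => xz zp; right; exists z => //; exists p.
apply: (sub_finite_set sub); rewrite finite_setU; split=> //.
by apply: bigcup_finite => // z _; exact: IHn.
Qed.

Lemma exists_far (M : {fset X}) n :
  locally_finite E -> infinite_set [set: X] ->
  exists y, forall z, z \in M -> ~ graph_ball n z y.
Proof.
move=> E_lf X_inf; pose B := \bigcup_(z in [set` M]) graph_ball n z.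
have B_fin : finite_set B.
  by apply: bigcup_finite => // z _; exact: graph_ball_finite.
have /set0P[y [_ yB]] : [set: X] `\` B != set0.
  apply/eqP => B0; apply: (infinite_setD X_inf B_fin).
  by rewrite B0; exact: finite_set0.
by exists y => z zM zy; apply: yB; exists z.
Qed.

Lemma exists_edge : graph_connected E -> infinite_set [set: X] ->
  exists x y, E x y /\ x != y.
Proof.
move=> E_conn X_inf.
have [a _] : [set: X] !=set0.
  by apply/set0P/eqP => X0; apply: X_inf; rewrite X0; exact: finite_set0.
have [b [_ /= ba]] : [set: X] `\` [set a] !=set0.
  apply/set0P/eqP => X0; apply: (infinite_setD X_inf (finite_set1 a)).
  by rewrite X0; exact: finite_set0.
have [p ap lp] := E_conn a b.
elim: p a ap lp ba => [|c p IHp] a /=; first by move=> _ ->.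
case/andP=> ac cp lp ba; have [eq_ac|neq_ac] := eqVneq a c; last by exists a, c.
by apply: (IHp c) => //; rewrite -eq_ac.
Qed.

End Balls.

(** * Changing the state of one site *)

Section Update.
Variables (S : Type) (star : S) (X : choiceType).
Implicit Types (eta : fconf star X).

Lemma finite_upd eta (x : X) (s : S) :
  finite_set [set z | (if z == x then s else sval eta z) <> star].
Proof.
have fin : finite_set ([set x] `|` [set z | sval eta z <> star]).
  by rewrite finite_setU; split=> //; exact: (svalP eta).
by apply: (sub_finite_set _ fin) => z /=; case: eqP => [->|_]; [left|right].
Qed.

Definition upd eta x s : fconf star X :=
  exist (fun e : X -> S => finite_set [set z | e z <> star]) _
    (finite_upd eta x s).

Definition vacuum : fconf star X := restr star fset0 (fun=> star).

Lemma vacuumE x : sval vacuum x = star.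
Proof. by rewrite restrE. Qed.

Lemma updE eta x s z : sval (upd eta x s) z = if z == x then s else sval eta z.
Proof. by []. Qed.

End Update.

(** * Locality of uniform functions *)

Section Locality.
Variables (R : realType) (S : Type) (star : S) (X : choiceType) (E : rel X).
Implicit Types (eta : fconf star X) (f : fconf star X -> R).

(** The form in which locality is used: a set with a site outside the ball of a
    fixed radius around another of its sites has diameter beyond the range. *)
Lemma uniform_range f : uniform E f -> exists n, forall (L : {fset X}) y z,
  y \in L -> z \in L -> ~ graph_ball E n y z -> component f L = 0.
Proof.
(* distances are integers, so those exceeding [truncn r] exceed [r] *)
case=> r _ fr; exists (Num.truncn r) => L y z yL zL yz; apply: fr.
rewrite /diam ifF; last by apply/eqP => L0; have : [set` L] y by []; rewrite L0.
apply: (@lt_le_trans _ _ (graph_dist E R y z)); last first.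
  by apply: ereal_sup_ubound; exists (y, z).
apply: (@lt_le_trans _ _ ((Num.truncn r).+1%:R%:E)%E).
  by rewrite lte_fin truncnS_gt.
apply: le_ereal_inf_tmp => _ [p [yp lp] <-]; rewrite lee_fin ler_nat ltnNge.
by apply/negP => szp; apply: yz; exists p.
Qed.

(** Both expansions are finite sums over the subsets of a common support. *)
Lemma expansion_diff f eta eta' : f eta' - f eta =
  \sum_(L \in [set: {fset X}])
    (component f L (sval eta') - component f L (sval eta)).
Proof.
have [CF _] := componentP f.
have [M etaM] := restr_supp eta; have [M' etaM'] := restr_supp eta'.
pose N := (M `|` M')%fset.
have etaN : restr star N (sval eta) = eta.
  rewrite -{1}etaM restr_restr (fsetIidPr _) //; exact: fsubsetUl.
have etaN' : restr star N (sval eta') = eta'.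
  rewrite -{1}etaM' restr_restr (fsetIidPr _) //; exact: fsubsetUr.
rewrite -{1}etaN -{1}etaN' !(expansion_restr _ _ (componentP f)) -sumrB.
rewrite (fsbigTE (fpowerset N)) // => L; rewrite fpowersetE => LN.
rewrite -etaN -etaN' !(Cspace_restr _ _ (CF L)).
by rewrite (negPf LN) subrr.
Qed.

(** Links invariance, which is expressed by component differences on the whole
    of [S^X], to plain values of [g] on finitely supported configurations. *)
Lemma diff_fconf (g : Cunif R E star) eta eta' :
  diff (C0unif_class g) (sval eta) (sval eta') = g eta' - g eta.
Proof.
rewrite diffE expansion_diff; apply: fsbig_widen => // L [_ /= nL].
have [CF _] := componentP g; apply/eqP; rewrite subr_eq0; apply/eqP.
apply: (CF L).1 => x xL; apply: contrapT => neq; apply: nL.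
by exists x => // eq_x; apply: neq.
Qed.

(** Only components of sets [L] containing [y] can tell the two sides apart.
    If such an [L] has another site in [M], it is too wide for the range of
    [f]; if it has another site outside [M], its component vanishes on both
    configurations, which are at the base state there.  What remains is the
    singleton [{y}], whose contribution does not involve [eta]. *)
Lemma far_increment f n (M : {fset X}) eta y s :
  (forall (L : {fset X}) a b,
     a \in L -> b \in L -> ~ graph_ball E n a b -> component f L = 0) ->
  restr star M (sval eta) = eta -> y \notin M ->
  (forall z, z \in M -> ~ graph_ball E n z y) ->
  f (upd eta y s) - f eta =
  component f [fset y]%fset (fun=> s) - component f [fset y]%fset (fun=> star).
Proof.
move=> f_range etaM yM far; have [CF _] := componentP f.
have eta_out z : z \notin M -> sval eta z = star.
  by rewrite -etaM restrE => /negPf ->.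
rewrite expansion_diff (fsbigTE [fset [fset y]]%fset) => [|L].
  rewrite big_seq_fset1.
  by congr (_ - _); apply: (CF _).1 => z; rewrite inE => /eqP ->;
    rewrite ?updE ?eqxx ?eta_out.
rewrite inE => Ly; have [yL|yL] := boolP (y \in L); last first.
  apply/eqP; rewrite subr_eq0; apply/eqP; apply: (CF L).1 => z zL.
  by rewrite updE; case: eqP => // zy; rewrite -zy zL in yL.
have [z zL zy] : exists2 z, z \in L & z != y.
  apply: contrapT => nz; move/eqP: Ly; apply; apply/fsetP => z; rewrite inE.
  apply/idP/eqP => [zL|-> //]; apply: contrapT => /eqP zy.
  by apply: nz; exists z.
have [zM|zM] := boolP (z \in M).
  by rewrite (f_range L z y) ?subrr //; exact: far.
have LN : ~~ (L `<=` y |` M)%fset.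
  by apply: contraNN zM => /fsubsetP/(_ z zL); rewrite !inE (negPf zy).
(* both configurations are supported in [y |` M], which does not contain [L] *)
have supp (e : fconf star X) : (forall w, w \notin (y |` M)%fset ->
    sval e w = star) -> component f L (sval e) = 0.
  move=> out; rewrite -[RHS]((CF L).2 _ LN e); congr (component f L (sval _)).
  by apply: fconf_eqP => w; rewrite restrE; case: ifPn => // /out.
rewrite !supp ?subrr // => w; rewrite !inE negb_or => /andP[wy wM].
  exact: eta_out.
by rewrite updE (negPf wy) eta_out.
Qed.

End Locality.

(** * Invariance under exchanges of states *)

Section Exchange.
Variables (R : realType) (S : Type) (phi : rel (S * S)).
Variables (star : S) (X : choiceType) (E : rel X) (f : fconf star X -> R).
Hypothesis f_inv : forall eta eta' : fconf star X,
  transition phi E (sval eta) (sval eta') -> f eta' = f eta.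
Implicit Types (eta : fconf star X).

Definition exchange (x y : X) eta : fconf star X :=
  upd (upd eta x (sval eta y)) y (sval eta x).

(** A path of [phi] from the states at the two ends of an edge lifts to a chain
    of transitions along that edge.  The ends must be distinct: on a loop, only
    pairs of equal states occur. *)
Lemma joined_invariant x y eta s t : E x y -> x != y ->
  joined phi (sval eta x, sval eta y) (s, t) ->
  f (upd (upd eta x s) y t) = f eta.
Proof.
move=> xy neq_xy [p]; move e: (sval eta x, sval eta y) => st ph lp.
elim: p st eta e ph lp => [|[u v] p IHp] st eta e /=.
  move=> _ st_eq; congr f; apply: fconf_eqP => z; rewrite !updE.
  rewrite st_eq in e; case: e => <- <-.
  by case: eqP => [-> //|_]; case: eqP => [->|].
case/andP=> st_uv ph lp; pose eta' := upd (upd eta x u) y v.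
have eta'x : sval eta' x = u by rewrite !updE (negPf neq_xy) eqxx.
have eta'y : sval eta' y = v by rewrite !updE eqxx.
transitivity (f eta').
  rewrite -(IHp (u, v) eta') ?eta'x ?eta'y //.
  by congr f; apply: fconf_eqP => z; rewrite !updE; do 2?case: eqP.
apply: f_inv; exists x, y; split=> //; first by rewrite e eta'x eta'y.
by move=> z /eqP zx /eqP zy; rewrite !updE (negPf zy) (negPf zx).
Qed.

(** Transpositions along the edges of a connected graph generate all
    transpositions; on an edge, exchangeability joins the states of the two ends
    to the exchanged states. *)
Lemma exchange_invariant x y eta : exchangeable phi -> graph_connected E ->
  f (exchange x y eta) = f eta.
Proof.
move=> phi_exch E_conn; have [p xp lp] := E_conn x y.
have exchange_id a e : exchange a a e = e.
  by apply: fconf_eqP => z; rewrite !updE; case: eqP => [->|].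
have edge a b e : E a b -> f (exchange a b e) = f e.
  move=> ab; have [-> |ab'] := eqVneq a b; first by rewrite exchange_id.
  exact: joined_invariant.
elim: p x eta xp lp => [|c p IHp] x eta /=.
  by move=> _ ->; rewrite exchange_id.
case/andP=> xc cp lp.
have [->|yx] := eqVneq y x; first by rewrite exchange_id.
have [->|yc] := eqVneq y c; first exact: edge.
have [eq_cx|cx] := eqVneq c x; first by rewrite -eq_cx; exact: IHp.
(* the transposition (x y) is the conjugate of (c y) by (x c) *)
have -> : exchange x y eta = exchange x c (exchange c y (exchange x c eta)).
  apply: fconf_eqP => z; rewrite !updE !eqxx.
  rewrite ![_ == y]eq_sym (negPf yx) (negPf yc) ![x == c]eq_sym (negPf cx).
  rewrite ?eqxx.
  have [->|zy] := eqVneq z y; first by rewrite (negPf yx) (negPf yc).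
  have [->|zx] := eqVneq z x; first by rewrite eq_sym (negPf cx).
  by case: eqP => // ->; rewrite ?eqxx.
by rewrite edge // IHp // edge.
Qed.

End Exchange.
(** * Additivity of the increments *)

Section Additivity.
Variables (R : realType) (S : Type) (star : S) (X : choiceType) (E : rel X).
Variables (f : fconf star X -> R) (n : nat) (x0 : X).
Hypotheses (E_lf : locally_finite E) (X_inf : infinite_set [set: X]).
Hypothesis f_range : forall (L : {fset X}) y z,
  y \in L -> z \in L -> ~ graph_ball E n y z -> component f L = 0.
Hypothesis f_exchange : forall x y eta, f (exchange x y eta) = f eta.
Implicit Types (eta : fconf star X) (x y : X) (s t : S).

(** By [move_particle] the site [x0] does not matter. *)
Definition increment s : R := f (upd (vacuum star X) x0 s) - f (vacuum star X).

Lemma move_particle eta x y s : sval eta x = star -> sval eta y = star ->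
  f (upd eta x s) = f (upd eta y s).
Proof.
move=> xs ys; have [-> //|neq_xy] := eqVneq x y.
rewrite -(f_exchange x y (upd eta x s)); congr f.
apply: fconf_eqP => z; rewrite !updE eqxx [y == x]eq_sym (negPf neq_xy).
by have [//|_] := eqVneq z y; have [->|] := eqVneq z x; rewrite ?xs ?ys.
Qed.

(** The heart of the argument: symmetry moves the new particle out of the range
    of all the others, where locality makes its contribution independent of
    them. *)
Lemma increment_vacant eta x s : sval eta x = star ->
  f (upd eta x s) = f eta + increment s.
Proof.
move=> xs; have [M etaM] := restr_supp eta.
have [y far] := exists_far M n E_lf X_inf.
have yM : y \notin M by apply/negP => /far; apply; exists [::].
have ys : sval eta y = star by rewrite -etaM restrE (negPf yM).
rewrite (move_particle s xs ys) /increment.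
rewrite (@move_particle (vacuum star X) x0 y) ?vacuumE //.
rewrite (@far_increment _ _ _ _ _ _ _ fset0 (vacuum star X) _ _ f_range) //.
- by rewrite -(far_increment s f_range etaM yM far) addrC subrK.
- by rewrite /vacuum restr_restr fset0I.
Qed.

Lemma increment_base : increment star = 0.
Proof.
rewrite /increment (_ : upd _ _ _ = vacuum star X) ?subrr //.
by apply: fconf_eqP => z; rewrite updE vacuumE; case: eqP.
Qed.

Lemma invariant_sum eta :
  f eta = f (vacuum star X) + conserved_sum_fun increment eta.
Proof.
have sumM (M : {fset X}) : f (restr star M (sval eta)) =
    f (vacuum star X) + \sum_(x <- M) increment (sval eta x).
  elim/fset1U_rect: M => [|x M xM IHM].
    rewrite big_seq_fset0 addr0; congr f; apply: fconf_eqP => z.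
    by rewrite restrE vacuumE.
  rewrite big_fsetU1 //= [increment _ + _]addrC addrA -IHM.
  rewrite -(@increment_vacant _ x) ?restrE ?(negPf xM) //.
  congr f; apply: fconf_eqP => z; rewrite updE !restrE !inE.
  by case: eqP => [->|].
have [M etaM] := restr_supp eta; rewrite -{1}etaM sumM; congr (_ + _).
rewrite /conserved_sum_fun (fsbigTE M) => [|x xM].
  by apply: eq_bigr => x _; rewrite increment_base subr0.
by rewrite -etaM restrE (negPf xM) subrr.
Qed.

(** The states at the two ends of an edge, in an otherwise empty configuration,
    can be replaced by any states joined to them. *)
Lemma increment_conserved (phi : rel (S * S)) : graph_connected E ->
  (forall eta eta', transition phi E (sval eta) (sval eta') ->
     f eta' = f eta) ->
  conserved_quantity phi increment.
Proof.
move=> E_conn f_inv [s1 s2] [t1 t2] st /=.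
have [x [y [xy neq_xy]]] := exists_edge E_conn X_inf.
pose pair s t := upd (upd (vacuum star X) x s) y t.
have pairE s t : f (pair s t) = f (vacuum star X) + (increment s + increment t).
  have neq_yx : y == x = false by rewrite eq_sym; exact: negPf.
  by rewrite /pair !increment_vacant ?updE ?neq_yx ?vacuumE ?addrA.
have : f (pair t1 t2) = f (pair s1 s2).
  rewrite -(@joined_invariant _ _ _ _ _ _ _ f_inv x y (pair s1 s2) t1 t2) //.
    congr f; apply: fconf_eqP => z; rewrite !updE.
    by have [//|_] := eqVneq z y; have [] := eqVneq z x.
  by rewrite !updE (negPf neq_xy) !eqxx.
by rewrite !pairE => /addrI ->.
Qed.

End Additivity.

(** * Invariant uniform functions *)

Theorem theorem1p3 (R : realType)
    (S : Type) (phi : rel (S * S)) (phi_sym : symmetric phi)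
    (phi_exch : exchangeable phi)
    (X : choiceType) (E : rel X) (E_sym : symmetric E)
    (E_conn : graph_connected E) (E_lf : locally_finite E)
    (X_inf : infinite_set [set: X])
    (star : S) (f : C0unif R E star) :
  transition_invariant phi f ->
  exists2 xi : S -> R,
    conserved_quantity phi xi & f = conserved_sum E star xi.
Proof.
pose g : Cunif R E star := repr f.
have <- : C0unif_class g = f by rewrite /C0unif_class reprK.
move: g => {f} g g_diff.
have g_inv (eta eta' : fconf star X) :
    transition phi E (sval eta) (sval eta') -> g eta' = g eta.
  by move=> /g_diff; rewrite diff_fconf => /eqP; rewrite subr_eq0 => /eqP.
have g_exch x y (eta : fconf star X) : g (exchange x y eta) = g eta.
  exact: (exchange_invariant g_inv x y eta phi_exch E_conn).
have g_unif : uniform E g by apply/asboolP; case: (g).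
have [n g_range] := uniform_range g_unif.
have [x0 _] := exists_far fset0 0 E_lf X_inf.
exists (increment g x0).
  exact: (increment_conserved x0 E_lf X_inf g_range g_exch E_conn g_inv).
apply/eqP; rewrite /conserved_sum /C0unif_class -Quotient.idealrBE.
apply/asboolP; exists (g (vacuum star X)) => eta.
rewrite -[LHS]/(g eta - conserved_sum_fun (increment g x0) eta).
have -> := invariant_sum x0 E_lf X_inf g_range g_exch eta.
exact: addrK.
Qed.
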